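(* For every $n\ge4$, the Garside element of the Artin monoid $\mathcal{M}(D_n)$ is $$\Delta(D_n)=x_1(x_2x_1)\cdots(x_{n-1}x_{n-2}\cdots x_1)\cdot(x_nx_{n-2}x_{n-3}\cdots x_1)(x_{n-1}x_{n-2}\cdots x_2)(x_nx_{n-2}\cdots x_3)\cdots,$$ where the second part is the product $Q_1Q_2\cdots Q_{n-1}$ with $Q_j=x_{\epsilon_j}x_{n-2}x_{n-3}\cdots x_j$ for $1\le j\le n-2$ and $Q_{n-1}=x_{\epsilon_{n-1}}$, and $\epsilon_j=n$ for $j$ odd, $\epsilon_j=n-1$ for $j$ even.
   Context: The Coxeter graph $D_n$ has vertices $x_1,\dots,x_n$ and (unlabelled) edges $x_i - x_{i+1}$ for $1\le i\le n-2$ (so $x_1,\dots,x_{n-1}$ form a chain) together with an edge $x_{n-2} - x_n$. $\mathcal{M}(D_n)$ is the monoid with generators $x_1,\dots,x_n$ and relations $x_ix_jx_i=x_jx_ix_j$ if $x_i,x_j$ are joined by an edge and $x_ix_j=x_jx_i$ otherwise. The notation $\alpha\mid_L\beta$ means $\beta=\alpha\rho$ for some element $\rho$. The Garside element $\Delta$ of this monoid is the unique element such that $x_i\mid_L\Delta$ for all $i$, and whenever $x_i\mid_L\omega$ for all $i$ then $\Delta\mid_L\omega$. *)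

(* Defs.v *)
(* Mathematical Components world, with classical reasoning from boolp. *)
From HB Require Import structures.
From mathcomp Require Import all_boot.
From mathcomp Require Import boolp.

Set Implicit Arguments.
Unset Strict Implicit.
Unset Printing Implicit Defensive.

Local Open Scope group_scope.
Local Open Scope quotient_scope.

(* An unlabelled Coxeter graph is given by its adjacency relation [e], expected
   to be symmetric and irreflexive, on a finite vertex set [T]. *)
Inductive artin_rel (T : finType) (e : rel T) : seq T -> seq T -> Prop :=
| artin_braid i j : e i j -> artin_rel e [:: i; j; i] [:: j; i; j]
| artin_comm i j : ~~ e i j -> artin_rel e [:: i; j] [:: j; i].

Inductive artin_cong (T : finType) (e : rel T) : seq T -> seq T -> Prop :=
| artin_cong_rel u v a b :
    artin_rel e a b -> artin_cong e (u ++ a ++ v) (u ++ b ++ v)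
| artin_cong_refl a : artin_cong e a a
| artin_cong_sym a b : artin_cong e a b -> artin_cong e b a
| artin_cong_trans b a c :
    artin_cong e a b -> artin_cong e b c -> artin_cong e a c.

Definition artin_congb (T : finType) (e : rel T) : rel (seq T) :=
  fun a b => `[< artin_cong e a b >].

Lemma artin_congb_refl (T : finType) (e : rel T) : reflexive (artin_congb e).
Proof. by move=> a; apply/asboolP; exact: artin_cong_refl. Qed.

Lemma artin_congb_sym (T : finType) (e : rel T) : symmetric (artin_congb e).
Proof. by move=> a b; apply/asboolP/asboolP; exact: artin_cong_sym. Qed.

Lemma artin_congb_trans (T : finType) (e : rel T) : transitive (artin_congb e).
Proof.
move=> b a c /asboolP ab /asboolP bc; apply/asboolP.
exact: artin_cong_trans ab bc.
Qed.

Canonical artin_equiv (T : finType) (e : rel T) :=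
  EquivRel (artin_congb e) (artin_congb_refl e) (artin_congb_sym e)
    (@artin_congb_trans T e).

Definition artin_monoid (T : finType) (e : rel T) := {eq_quot (artin_equiv e)}.

HB.instance Definition _ (T : finType) (e : rel T) :=
  Choice.on (artin_monoid e).

Definition artin_class (T : finType) (e : rel T) (a : seq T) : artin_monoid e :=
  \pi_({eq_quot (artin_equiv e)}) a.

Definition artin_word (T : finType) (e : rel T) (x : artin_monoid e) : seq T :=
  repr (x : {eq_quot (artin_equiv e)}).

Definition artin_one (T : finType) (e : rel T) : artin_monoid e :=
  artin_class e [::].

Definition artin_mul (T : finType) (e : rel T) (x y : artin_monoid e) :
    artin_monoid e :=
  artin_class e (artin_word x ++ artin_word y).

Lemma artin_classP (T : finType) (e : rel T) (a b : seq T) :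
  artin_class e a = artin_class e b <-> artin_cong e a b.
Proof.
split=> [/eqP|ab]; first by rewrite /artin_class eqmodE => /asboolP.
by apply/eqP; rewrite /artin_class eqmodE; apply/asboolP.
Qed.

Lemma artin_wordK (T : finType) (e : rel T) :
  cancel (@artin_word T e) (artin_class e).
Proof. by move=> x; rewrite /artin_class /artin_word reprK. Qed.

Lemma artin_cong_catl (T : finType) (e : rel T) (u a b : seq T) :
  artin_cong e a b -> artin_cong e (u ++ a) (u ++ b).
Proof.
elim=> {a b} [w v a b ab|a|a b _|b a c _ ab _].
- by rewrite [u ++ _]catA [u ++ (w ++ b ++ v)]catA; exact: artin_cong_rel.
- exact: artin_cong_refl.
- exact: artin_cong_sym.
- exact: artin_cong_trans.
Qed.

Lemma artin_cong_catr (T : finType) (e : rel T) (v a b : seq T) :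
  artin_cong e a b -> artin_cong e (a ++ v) (b ++ v).
Proof.
elim=> {a b} [u w a b ab|a|a b _|b a c _ ab _].
- by rewrite -[_ ++ v]catA -[(a ++ w) ++ v]catA -[(u ++ b ++ w) ++ v]catA
    -[(b ++ w) ++ v]catA; exact: artin_cong_rel.
- exact: artin_cong_refl.
- exact: artin_cong_sym.
- exact: artin_cong_trans.
Qed.

Lemma artin_classM (T : finType) (e : rel T) (a b : seq T) :
  artin_mul (artin_class e a) (artin_class e b) = artin_class e (a ++ b).
Proof.
apply/artin_classP.
apply: (@artin_cong_trans _ _ (a ++ artin_word (artin_class e b))).
  by apply/artin_cong_catr/artin_classP; rewrite artin_wordK.
by apply/artin_cong_catl/artin_classP; rewrite artin_wordK.
Qed.

Lemma artin_mulA (T : finType) (e : rel T) : associative (@artin_mul T e).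
Proof.
move=> x y z; rewrite -[x]artin_wordK -[y]artin_wordK -[z]artin_wordK.
by rewrite !artin_classM catA.
Qed.

Lemma artin_1mul (T : finType) (e : rel T) :
  left_id (artin_one e) (@artin_mul T e).
Proof. by move=> x; rewrite -[x]artin_wordK artin_classM. Qed.

Lemma artin_mul1 (T : finType) (e : rel T) :
  right_id (artin_one e) (@artin_mul T e).
Proof. by move=> x; rewrite -[x]artin_wordK artin_classM cats0. Qed.

HB.instance Definition _ (T : finType) (e : rel T) :=
  isMonoid.Build (artin_monoid e) (@artin_mulA T e) (@artin_1mul T e)
    (@artin_mul1 T e).

Definition artin_gen (T : finType) (e : rel T) (i : T) : artin_monoid e :=
  artin_class e [:: i].

Definition ldvd (M : monoidType) (a b : M) : Prop := exists r : M, b = a * r.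

Definition is_garside (T : finType) (e : rel T) (d : artin_monoid e) : Prop :=
  (forall i : T, ldvd (artin_gen e i) d) /\
  (forall w : artin_monoid e, (forall i : T, ldvd (artin_gen e i) w) -> ldvd d w).

(* The vertex x_k (1 <= k <= n) of D_n is the ordinal of value k - 1. *)
Definition dynkinD (n : nat) : rel 'I_n := fun i j =>
  let edge k l := [&& 1 <= k, k <= n - 2 & l == k.+1]%N
                  || ((k == n - 2) && (l == n))%N in
  edge i.+1 j.+1 || edge j.+1 i.+1.

(* The generator x_k for 1 <= k <= n; other values of k are not used. *)
Definition xD (n k : nat) : artin_monoid (@dynkinD n) :=
  oapp (artin_gen (@dynkinD n)) 1 (insub k.-1).

(* x_b x_(b-1) ... x_a, which is 1 when b < a. *)
Definition descD (n b a : nat) : artin_monoid (@dynkinD n) :=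
  \prod_(i <- rev (index_iota a b.+1)) xD n i.

Definition epsD (n j : nat) : nat := if odd j then n else n.-1.

(* For j = n - 1 the second factor is empty, so that Q_(n-1) = x_(eps (n-1)). *)
Definition QD (n j : nat) : artin_monoid (@dynkinD n) :=
  xD n (epsD n j) * descD n (n - 2) j.

(* Main.v *)
Require Import Defs.
From mathcomp Require Import all_boot.
From mathcomp Require Import zify.

Set Implicit Arguments.
Unset Strict Implicit.
Unset Printing Implicit Defensive.

Local Open Scope group_scope.

(** Two facts have to be proved: every generator left-divides the product, and
    the product left-divides every w that all the generators left-divide.
    Uniqueness is then formal, because the relations preserve the length of
    words, so that mutual left divisibility is equality.

    The second fact rests on the reduction lemma of Garside and
    Brieskorn-Saito, [all_reducible]: if x_i a = x_j b, then a = b when i = j,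
    and otherwise both sides are multiples of the
    least common multiple x_i x_j x_i or x_i x_j of the two generators. The
    proof is an induction on the length of a and on the derivation of the
    equality; composing two derivations is a case analysis on the subgraph
    spanned by three vertices. It works for any graph without triangles, and
    it yields left cancellation.

    The rest is calculus with chains, that is, words c s in which consecutive
    letters are adjacent and all other pairs of letters commute. If s' denotes s
    with its last letter removed (and s is not empty), then s c s = c s c s'
    ([chain_braid]); and if c left-divides s z, then c s left-divides z
    ([chain_dvd]).

    For the first part A = x_1 (x_2 x_1) ... of the product this gives, one
    block at a time, that x_1, ..., x_(n-1) divide A and that A divides all
    their common multiples. For the second part put B_j = x_(n-2) ... x_j, so
    that Q_j = x_(eps j) B_j with eps j alternating between n and n - 1, and
    A = A' B_1 x_(n-1) B_1 with A' a word that commutes with x_n. If x_n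
    divides A w', cancelling A' and B_1 leaves an equation
    x_(n-1) B_1 w' = x_n B_1 z'. An equation of this form splits Q_1 off from
    w' and reproduces itself with B_2 in place of B_1 and the two end
    generators exchanged ([zigzag_dvd]); iterating, Q_1 ... Q_(n-1) divides w'.
    Read backwards, the same exchange moves x_n through A Q_1 ... Q_(n-1) to the
    front ([zigzag_swap]). *)

(** * Length and uniqueness of the Garside element *)

Section Length.

Variables (T : finType) (e : rel T).
Local Notation M := (artin_monoid e).
Local Notation x := (artin_gen e).

Lemma artin_cong_size (u v : seq T) : artin_cong e u v -> size u = size v.
Proof.
elim=> {u v} // [u v a b ab|a b c _ -> _ ->] //.
by rewrite !size_cat; case: ab.
Qed.

Definition artin_length (a : M) : nat := size (artin_word a).

Arguments artin_length a%_g.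

Lemma artin_length_class u : artin_length (artin_class e u) = size u.
Proof. by apply: artin_cong_size; apply/artin_classP; rewrite artin_wordK. Qed.

Lemma artin_lengthM (a b : M) :
  artin_length (a * b) = (artin_length a + artin_length b)%N.
Proof.
rewrite -[a]artin_wordK -[b]artin_wordK.
have -> : artin_class e (artin_word a) * artin_class e (artin_word b) =
  artin_class e (artin_word a ++ artin_word b) by exact: artin_classM.
by rewrite !artin_length_class size_cat.
Qed.

Lemma artin_length_gen i : artin_length (x i) = 1%N.
Proof. exact: artin_length_class. Qed.

Lemma artin_length_eq0 (a : M) : artin_length a = 0%N -> a = 1.
Proof. by move=> /size0nil a0; rewrite -[a]artin_wordK a0. Qed.

(** The cofactors have length zero, hence are trivial; cancellation is not
    involved. *)
Lemma ldvd_anti (a b : M) : ldvd a b -> ldvd b a -> a = b.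
Proof.
move=> [r rE] [s sE].
suff r1 : r = 1 by rewrite rE r1 mulg1.
by apply: artin_length_eq0; move: (congr1 artin_length sE);
  rewrite rE !artin_lengthM; lia.
Qed.

Lemma is_garside_uniq (d d' : M) : is_garside d -> is_garside d' -> d = d'.
Proof.
by move=> [d1 d2] [d'1 d'2]; apply: ldvd_anti; [exact: d2|exact: d'2].
Qed.

Lemma artin_class_cons i u : artin_class e (i :: u) = x i * artin_class e u.
Proof. by symmetry; exact: artin_classM. Qed.

Lemma artin_class_cat u v :
  artin_class e (u ++ v) = artin_class e u * artin_class e v.
Proof. by symmetry; exact: artin_classM. Qed.

Lemma gen_braid i j (z : M) : e i j ->
  x i * (x j * (x i * z)) = x j * (x i * (x j * z)).
Proof.
move=> ij; rewrite -[z]artin_wordK -!artin_class_cons; apply/artin_classP.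
exact: (@artin_cong_rel _ _ [::] _ _ _ (artin_braid ij)).
Qed.

Lemma gen_commute i j (z : M) : ~~ e i j -> x i * (x j * z) = x j * (x i * z).
Proof.
move=> ij; rewrite -[z]artin_wordK -!artin_class_cons; apply/artin_classP.
exact: (@artin_cong_rel _ _ [::] _ _ _ (artin_comm ij)).
Qed.

End Length.

Arguments artin_length {T e} a%_g.

(** * The reduction lemma for common multiples of two generators *)

Section Reduction.

Variables (T : finType) (e : rel T).
Hypothesis e_sym : symmetric e.
Hypothesis e_trianglefree : forall i j k, e i j -> e j k -> ~~ e i k.
Local Notation M := (artin_monoid e).
Local Notation x := (artin_gen e).

(** The right complement: x_i * residue i j = x_j * residue j i is the least
    common multiple of x_i and x_j. *)
Definition residue (i j : T) : M :=
  if i == j then 1 else if e i j then x j * x i else x j.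

Definition lcm_factored i (a : M) j (b : M) : Prop :=
  exists c, a = residue i j * c /\ b = residue j i * c.

(** The reduction lemma for elements of bounded length, the hypothesis of the
    induction on length. *)
Definition reducible_upto m : Prop := forall i j (a b : M),
  (artin_length (x i * a) <= m)%N -> x i * a = x j * b -> lcm_factored i a j b.

Lemma residue_id i : residue i i = 1.
Proof. by rewrite /residue eqxx. Qed.

Lemma residue_edge i j : i != j -> e i j -> residue i j = x j * x i.
Proof. by rewrite /residue => /negPf-> ->. Qed.

Lemma residue_far i j : i != j -> ~~ e i j -> residue i j = x j.
Proof. by rewrite /residue => /negPf-> /negPf->. Qed.

Lemma lcm_factored_sym i a j b : lcm_factored i a j b -> lcm_factored j b i a.
Proof. by case=> c [? ?]; exists c. Qed.

Lemma reducible_id m i a b : reducible_upto m ->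
  (artin_length (x i * a) <= m)%N -> x i * a = x i * b -> a = b.
Proof.
by move=> Hm la /(Hm _ _ _ _ la)[c]; rewrite residue_id mul1g => -[-> ->].
Qed.

Lemma reducible_edge m i j a b : reducible_upto m -> i != j -> e i j ->
  (artin_length (x i * a) <= m)%N -> x i * a = x j * b ->
  exists c, a = x j * (x i * c) /\ b = x i * (x j * c).
Proof.
move=> Hm nij ij la /(Hm _ _ _ _ la)[c].
rewrite (residue_edge nij ij) residue_edge -?mulgA; [by exists c | |].
  by rewrite eq_sym.
by rewrite e_sym.
Qed.

Lemma reducible_far m i j a b : reducible_upto m -> i != j -> ~~ e i j ->
  (artin_length (x i * a) <= m)%N -> x i * a = x j * b ->
  exists c, a = x j * c /\ b = x i * c.
Proof.
move=> Hm nij ij la /(Hm _ _ _ _ la)[c].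
rewrite (residue_far nij ij) residue_far; [by exists c | |].
  by rewrite eq_sym.
by rewrite e_sym.
Qed.

(** The case of three distinct vertices. The element on which the two
    factorizations agree is shorter than x_i a, so the reduction lemma may be
    applied to it, repeatedly, until a and b are explicit products of
    generators with a common tail; the braid relations then exhibit the common
    factor. The subgraph spanned by i, h and j has at most two edges, being
    triangle-free: a triangle would give the affine group of type A_2, where
    the three generators have no common multiple. *)
Lemma lcm_factored_cube m i h j (c1 c2 : M) : reducible_upto m ->
    i != h -> j != h -> i != j ->
    (artin_length (residue h i * c1) <= m)%N ->
    residue h i * c1 = residue h j * c2 ->
  lcm_factored i (residue i h * c1) j (residue j h * c2).
Proof.
move=> Hm.
(* The statement is symmetric in i and j, so if h has just one neighbour among
   them, it may be taken to be j. *)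
wlog hij : i j c1 c2 / e h i ==> e h j => [W nih njh nij lc E|].
  case: (boolP (e h i ==> e h j)) => [hij|]; first exact: W.
  rewrite negb_imply => /andP[_ /negPf hj].
  by apply/lcm_factored_sym/W; rewrite -?E ?hj 1?[j == i]eq_sym.
move=> nih njh nij lc E.
have [nhi nhj nji] : [/\ h != i, h != j & j != i] by split; rewrite eq_sym.
have len1 k a l b : x k * a = x l * b -> artin_length a = artin_length b.
  move/(congr1 artin_length).
  by rewrite !artin_lengthM !artin_length_gen => -[].
case hi: (e h i) hij => /= hj.
  have ih : e i h by rewrite e_sym.
  have jh : e j h by rewrite e_sym.
  have ij : ~~ e i j by apply: (e_trianglefree ih).
  have ji : ~~ e j i by rewrite e_sym.
  move: E lc; rewrite !residue_edge // -!mulgA => E lc.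
  have [d [E1 E2]] := reducible_far Hm nij ij lc E.
  have [f [Ec1 Ed]] : exists f, c1 = x j * (x h * f) /\ d = x h * (x j * f).
    apply: (reducible_edge Hm nhj hj _ E1).
    by move: lc; rewrite !artin_lengthM !artin_length_gen; lia.
  have [g [Ec2 Ed']] : exists g, c2 = x i * (x h * g) /\ d = x h * (x i * g).
    apply: (reducible_edge Hm nhi hi _ E2).
    move: lc (len1 _ _ _ _ E).
    by rewrite !artin_lengthM !artin_length_gen; lia.
  have E3 : x j * f = x i * g.
    apply: (reducible_id Hm _ (etrans (esym Ed) Ed')).
    by move: lc; rewrite Ec1 !artin_lengthM !artin_length_gen; lia.
  have [k [Ef Eg]] : exists k, f = x i * k /\ g = x j * k.
    apply: (reducible_far Hm nji ji _ E3).
    by move: lc; rewrite Ec1 !artin_lengthM !artin_length_gen; lia.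
  exists (x h * (x j * (x i * (x h * k)))).
  rewrite (residue_far nij ij) (residue_far nji ji) Ec1 Ec2 Ef Eg; split.
    rewrite [in LHS](gen_commute _ ij) [in LHS](gen_braid _ ih).
    by rewrite [in LHS](gen_braid _ hj).
  rewrite [in LHS](gen_commute _ ji) [in LHS](gen_braid _ jh).
  by rewrite [in LHS](gen_braid _ hi) [in LHS](gen_commute _ ij).
have {}hi := negbT hi; have ih : ~~ e i h by rewrite e_sym.
case hj: (e h j) hj => _.
  have jh : e j h by rewrite e_sym.
  move: E lc; rewrite (residue_far nhi hi) (residue_edge nhj hj).
  rewrite (residue_far nih ih) (residue_edge njh jh) -!mulgA => E lc.
  case ij: (e i j).
    have ji : e j i by rewrite e_sym.
    have [d [Ec1 E2]] := reducible_edge Hm nij ij lc E.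
    have [f [Ec2 E3]] : exists f, c2 = x i * f /\ x j * d = x h * f.
      apply: (reducible_far Hm nhi hi _ E2).
      by move: lc; rewrite E !artin_lengthM !artin_length_gen; lia.
    have [g [Ed Ef]] : exists g, d = x h * (x j * g) /\ f = x j * (x h * g).
      apply: (reducible_edge Hm njh jh _ E3).
      by move: lc; rewrite Ec1 !artin_lengthM !artin_length_gen; lia.
    exists (x h * (x j * (x i * g))).
    rewrite !residue_edge // Ec1 Ec2 Ed Ef -!mulgA; split.
      rewrite [in LHS](gen_commute _ ih) [in LHS](gen_braid _ hj).
      by rewrite [in LHS](gen_braid _ ji) [in LHS](gen_commute _ hi).
    rewrite [in LHS](gen_braid _ ji) [in LHS](gen_commute _ ih).
    by rewrite [LHS](gen_commute _ hi) [in LHS](gen_braid _ hj).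
  have {}ij := negbT ij; have ji : ~~ e j i by rewrite e_sym.
  have [d [Ec1 E2]] := reducible_far Hm nij ij lc E.
  have [f [Ec2 Ed]] : exists f, c2 = x i * f /\ d = x h * f.
    apply: (reducible_far Hm nhi hi _ E2).
    by move: lc; rewrite E !artin_lengthM !artin_length_gen; lia.
  exists (x h * (x j * f)).
  rewrite !residue_far // Ec1 Ec2 Ed; split.
    by rewrite [in LHS](gen_braid _ hj).
  by rewrite [in LHS](gen_commute _ ji) [in LHS](gen_commute _ hi).
have {}hj := negbT hj; have jh : ~~ e j h by rewrite e_sym.
move: E lc; rewrite (residue_far nhi hi) (residue_far nhj hj).
rewrite (residue_far nih ih) (residue_far njh jh) => E lc.
case ij: (e i j).
  have ji : e j i by rewrite e_sym.
  have [d [-> ->]] := reducible_edge Hm nij ij lc E.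
  exists (x h * d); rewrite !residue_edge // -!mulgA.
  by rewrite !(gen_commute _ hj) !(gen_commute _ hi) (gen_commute _ hj).
have {}ij := negbT ij; have ji : ~~ e j i by rewrite e_sym.
have [d [-> ->]] := reducible_far Hm nij ij lc E.
exists (x h * d); rewrite !residue_far //.
by rewrite (gen_commute _ hj) (gen_commute _ hi).
Qed.

(** Composition of derivations: the only step of the induction on the
    derivation that uses the reduction lemma for shorter elements. *)
Lemma lcm_factored_trans m i (a : M) h y j b : reducible_upto m ->
    (artin_length y <= m)%N ->
  lcm_factored i a h y -> lcm_factored h y j b -> lcm_factored i a j b.
Proof.
move=> Hm ly [c1 [-> y1]] [c2 [y2 ->]].
have [ih|nih] := eqVneq i h.
  by subst i; exists c2; rewrite -y2 y1.
have [jh|njh] := eqVneq j h.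
  by subst j; exists c1; rewrite -y1 y2.
have [ij|nij] := eqVneq i j; last first.
  by apply: (lcm_factored_cube Hm) => //; rewrite -?y1.
subst j; exists (residue i h * c1); rewrite residue_id !mul1g; split=> //.
congr (_ * _); move: y2 ly; rewrite y1; rewrite /residue eq_sym (negPf nih).
case: (e h i); last by move=> E ly; rewrite (reducible_id Hm ly E).
rewrite -!mulgA => E ly.
have E' := reducible_id Hm ly E.
apply/esym/(reducible_id Hm _ E').
by move: ly; rewrite !artin_lengthM !artin_length_gen; lia.
Qed.

(** The conclusion of the reduction lemma in terms of words, in a form that
    makes sense for every pair of congruent words, as induction on the
    congruence requires. *)
Definition heads_factored (u v : seq T) : Prop :=
  match u, v with
  | i :: a, j :: b => lcm_factored i (artin_class e a) j (artin_class e b)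
  | _, _ => u = v
  end.

Lemma heads_factored_cong m (u v : seq T) : reducible_upto m ->
  artin_cong e u v -> (size u <= m.+1)%N -> heads_factored u v.
Proof.
move=> Hm; elim=> {u v} [u v a b ab|u|u v uv IH|v u w uv IH vw IH'] su.
- case: u su => [|h u] su /=; last first.
    exists (artin_class e (u ++ a ++ v)); rewrite residue_id !mul1g; split=> //.
    by apply/artin_classP/artin_cong_sym/artin_cong_rel.
  case: ab {su} => i j ij /=.
    have [<-|nij] := eqVneq i j.
      by exists (artin_class e [:: i, i & v]); rewrite residue_id !mul1g.
    have [nji ji] : j != i /\ e j i by rewrite eq_sym e_sym.
    exists (artin_class e v); rewrite !residue_edge //.
    by rewrite !artin_class_cons !mulgA.
  have [<-|nij] := eqVneq i j.
    by exists (artin_class e [:: i & v]); rewrite residue_id !mul1g.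
  have [nji ji] : j != i /\ ~~ e j i by rewrite eq_sym e_sym.
  exists (artin_class e v); rewrite !residue_far //.
  by rewrite !artin_class_cons.
- case: u su => //= i u _; exists (artin_class e u).
  by rewrite residue_id !mul1g.
- have := IH; rewrite (artin_cong_size uv) => /(_ su) {IH}.
  case: u {uv su} => [|i u]; case: v => [|j v] //=.
  exact: lcm_factored_sym.
- have suv := artin_cong_size uv; have svw := artin_cong_size vw.
  have := IH su; have := IH'; rewrite -suv => /(_ su) {IH IH'}.
  case: u v w su suv svw {uv vw} => [|i u] [|h v] [|j w] //= su [suv] svw.
  move=> vw uv; apply: (lcm_factored_trans Hm _ uv vw).
  by rewrite artin_length_class -suv.
Qed.

(** In a derivation between words of length m + 1 the parts behind the first
    letters have length m, so the case of length m suffices to compose its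
    steps. *)
Lemma all_reducible m : reducible_upto m.
Proof.
elim: m => [|m IH] i j a b; first by rewrite artin_lengthM artin_length_gen.
rewrite -[a]artin_wordK -[b]artin_wordK -!artin_class_cons artin_length_class.
by move=> sa /artin_classP /(heads_factored_cong IH)/(_ sa).
Qed.

Lemma gen_cancel i (a b : M) : x i * a = x i * b -> a = b.
Proof. exact: (reducible_id (@all_reducible _) (leqnn _)). Qed.

Lemma class_cancel u (a b : M) :
  artin_class e u * a = artin_class e u * b -> a = b.
Proof.
elim: u => [|i u IH]; first by rewrite !mul1g.
by rewrite artin_class_cons -!mulgA => /gen_cancel/IH.
Qed.

Lemma gen_eq_edge i j (a b : M) : i != j -> e i j -> x i * a = x j * b ->
  exists c, a = x j * (x i * c) /\ b = x i * (x j * c).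
Proof. by move=> nij ij; apply: (reducible_edge (@all_reducible _)). Qed.

Lemma gen_eq_far i j (a b : M) : i != j -> ~~ e i j -> x i * a = x j * b ->
  exists c, a = x j * c /\ b = x i * c.
Proof. by move=> nij ij; apply: (reducible_far (@all_reducible _)). Qed.

End Reduction.

(** * Chains of generators *)

Section Chains.

Variables (T : finType) (e : rel T).
Hypothesis e_sym : symmetric e.
Hypothesis e_trianglefree : forall i j k, e i j -> e j k -> ~~ e i k.
Local Notation x := (artin_gen e).
Local Notation W := (artin_class e).

Definition far (i j : T) : bool := (i != j) && ~~ e i j.

(** The word c :: s spans a path in the graph, in this order, without any
    further edge or repetition; the head c is kept apart because it plays the
    role of the new generator below. *)
Fixpoint chain (c : T) (s : seq T) : bool :=
  if s is h :: s' then [&& c != h, e c h, all (far c) s' & chain h s']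
  else true.

Lemma far_word_commute c u : all (far c) u -> x c * W u = W u * x c.
Proof.
elim: u => [|h u IH] /=; first by rewrite mulg1 mul1g.
case/andP=> /andP[_ ch] /IH cu.
by rewrite artin_class_cons gen_commute // cu mulgA.
Qed.

Lemma far_word_dvd c u (z t : artin_monoid e) :
  all (far c) u -> W u * z = x c * t -> exists z', z = x c * z' /\ t = W u * z'.
Proof.
elim: u z t => [|h u IH] z t /=.
  by rewrite mul1g => _ ->; exists t; rewrite mul1g.
case/andP=> /andP[nch ch] cu; rewrite artin_class_cons -mulgA => /esym E.
have [s [-> /(IH _ _ cu)[z' [-> ->]]]] :=
  gen_eq_far e_sym e_trianglefree nch ch E.
by exists z'; rewrite mulgA.
Qed.

(** For s = [:: h] this is the braid relation. In general, s = h s1: the letter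
    c passes through the first copy of s1, the induction hypothesis for the
    chain h :: s1 creates the factor h c h, and one braid relation brings c to
    the front. Since [belast c s] starts with c and drops the last letter, this
    is the identity s c s = c s c s', and for empty s it reads c = c. *)
Lemma chain_braid c s :
  chain c s -> W s * (x c * W s) = x c * (W s * W (belast c s)).
Proof.
elim: s c => [|h s IH] c /=; first by rewrite !mul1g.
case/and4P=> _ ch cs hs; rewrite !artin_class_cons.
rewrite -mulgA [W s * _]mulgA -far_word_commute // -!mulgA IH //.
rewrite -gen_braid //; congr (_ * (_ * _)).
by rewrite !mulgA far_word_commute.
Qed.

(** If the generator at the end of a chain divides s z, peeling off the letters
    of s one by one with the reduction lemma forces z to start with the whole
    chain c s. The cofactor t is then given by [chain_braid] and
    cancellation. *)
Lemma chain_dvd c s (z t : artin_monoid e) :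
    chain c s -> W s * z = x c * t ->
  exists z', z = x c * (W s * z') /\ t = W s * (W (belast c s) * z').
Proof.
move=> cs E; suff [z' zE] : exists z', z = x c * (W s * z').
  exists z'; split=> //; apply: (gen_cancel e_sym e_trianglefree (i := c)).
  by rewrite -E zE !mulgA; congr (_ * _); rewrite -!mulgA chain_braid.
elim: s c z t cs E => [|h s IH] c z t /=.
  by rewrite mul1g => _ ->; exists t; rewrite mul1g.
case/and4P=> nch ch cs hs; rewrite artin_class_cons -mulgA => /esym E.
have [r [_ E1]] := gen_eq_edge e_sym e_trianglefree nch ch E.
have [z1 [-> E2]] := far_word_dvd cs E1.
have [z' ->] := IH _ _ _ hs (esym E2).
by exists z'; rewrite -mulgA.
Qed.

End Chains.

(** * The two parts of the product in type D *)

Section DynkinD.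

(** The vertices are addressed by their numbers 1, ..., n through v, so that the
    words of the product are images of intervals of natural numbers. *)
Variables (n : nat) (v : nat -> 'I_n).
Hypothesis n_ge4 : (4 <= n)%N.
Hypothesis vE : forall k, (1 <= k <= n)%N -> v k = k.-1 :> nat.
Local Notation e := (@dynkinD n).
Local Notation x := (artin_gen e).
Local Notation W := (artin_class e).

Lemma dynkinD_sym : symmetric e.
Proof. by move=> i j; rewrite /dynkinD orbC. Qed.

Lemma dynkinD_trianglefree i j k : e i j -> e j k -> ~~ e i k.
Proof. rewrite /dynkinD; lia. Qed.

Let D_sym := dynkinD_sym.
Let D_tf := dynkinD_trianglefree.
Let n_gt0 : (0 < n)%N. Proof. by lia. Qed.

Lemma dynkinD_farE k l : (1 <= k <= n)%N -> (1 <= l <= n)%N ->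
  far e (v k) (v l) =
  [&& k != l, ~~ (l < n) || (k.+1 != l), ~~ (k < n) || (l.+1 != k),
     (k, l) != (n - 2, n)%N & (k, l) != (n, n - 2)%N].
Proof.
move=> hk hl; rewrite /far -val_eqE /dynkinD /= !vE // !xpair_eqE; lia.
Qed.

Lemma dynkinD_edge k l : (1 <= k < n)%N -> (1 <= l <= n)%N ->
  (l == k.+1) && (l < n) || ((k, l) == (n - 2, n)%N) ->
  e (v l) (v k) /\ v l != v k.
Proof. move=> hk hl; rewrite xpair_eqE -val_eqE /dynkinD /= !vE //; lia. Qed.

Lemma xDE k : (1 <= k <= n)%N -> xD n k = x (v k).
Proof.
move=> hk; have lk : (k.-1 < n)%N by lia.
rewrite /xD insubT /=; congr (artin_gen _ _); apply: val_inj.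
by rewrite /= vE.
Qed.

Definition desc b a : seq 'I_n := [seq v i | i <- rev (index_iota a b.+1)].

Lemma desc_nil b a : (b < a)%N -> desc b a = [::].
Proof.
by move=> ba; rewrite /desc /index_iota (eqP (_ : (b.+1 - a)%N == 0)%N).
Qed.

Lemma desc_cons b a : (a <= b.+1)%N -> desc b.+1 a = v b.+1 :: desc b a.
Proof.
move=> ab; rewrite /desc /index_iota subSn // -addn1 iotaD rev_cat /=.
by rewrite subnKC.
Qed.

Lemma desc_rcons b a : (a <= b)%N -> desc b a = rcons (desc b a.+1) (v a).
Proof.
by move=> ab; rewrite /desc /index_iota subSn // rev_cons map_rcons subSS.
Qed.

Lemma prod_gen s : \prod_(i <- s) x i = W s.
Proof.
by elim: s => [|i s IH]; rewrite ?big_nil // big_cons IH artin_class_cons.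
Qed.

Lemma descDE b a : (0 < a)%N -> (b <= n)%N -> descD n b a = W (desc b a).
Proof.
move=> a0 bn; rewrite -prod_gen big_map; apply: eq_big_seq => i.
by rewrite mem_rev mem_index_iota => hi; apply: xDE; lia.
Qed.

Lemma all_desc (P : pred 'I_n) b a :
  (forall i, (a <= i <= b)%N -> P (v i)) -> all P (desc b a).
Proof.
move=> H; apply/allP => _ /mapP[i + ->]; rewrite mem_rev mem_index_iota.
by move=> hi; apply: H; lia.
Qed.

(** The vertex x_(b+1) extends the chain x_b, ..., x_a along the stem of the
    graph; at the fork b = n - 2 the vertex x_n does so too. *)
Lemma chain_desc b a c : (0 < a)%N ->
  (c == b.+1) && (c < n) || (c == n) && (b == n - 2)%N ->
  chain e (v c) (desc b a).
Proof.
move=> a0; elim: b c => [|b IH] c hc; first by rewrite desc_nil.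
have [ab|ba] := leqP a b.+1; last by rewrite desc_nil.
rewrite desc_cons //=.
have [|||-> -> /=] := @dynkinD_edge b.+1 c; rewrite ?xpair_eqE; try lia.
rewrite IH; last by lia.
by rewrite andbT; apply: all_desc => i hi; rewrite dynkinD_farE ?xpair_eqE; lia.
Qed.

Lemma belast_desc c b a : (a <= b)%N -> belast c (desc b a) = c :: desc b a.+1.
Proof. by move=> ab; rewrite desc_rcons // belast_rcons. Qed.

(** The Garside element of type A on the vertices x_1, ..., x_k. *)
Definition DeltaA k : artin_monoid e := \prod_(1 <= i < k.+1) descD n i 1.

Lemma DeltaA0 : DeltaA 0 = 1.
Proof. by rewrite /DeltaA big_geq. Qed.

Lemma DeltaAS k : (k < n)%N -> DeltaA k.+1 = DeltaA k * W (desc k.+1 1).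
Proof. by move=> kn; rewrite /DeltaA big_nat_recr //= descDE. Qed.

Lemma DeltaA_far k c : (c <= n)%N ->
    (k.+1 < c < n) || (c == n) && (k.+2 < n) ->
  exists2 u, all (far e (v c)) u & DeltaA k = W u.
Proof.
move=> cn; elim: k => [|k IH] hc; first by exists [::]; rewrite ?DeltaA0.
have [|u cu uE] := IH; first by lia.
exists (u ++ desc k.+1 1); last by rewrite artin_class_cat -uE DeltaAS //; lia.
rewrite all_cat cu /=; apply: all_desc => i hi.
by rewrite dynkinD_farE ?xpair_eqE; lia.
Qed.

(** Only i = k is new when passing to k. The last two blocks are s and x_k s for
    the chain x_k, s = x_(k-1) ... x_1, so [chain_braid] brings x_k to the front
    of them, and it commutes with all earlier blocks. *)
Lemma gen_dvd_DeltaA k i :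
  (1 <= i <= k)%N -> (k < n)%N -> ldvd (x (v i)) (DeltaA k).
Proof.
elim: k => [|k IH] hi kn; first by lia.
have [ik|ki] := leqP i k.
  have [||r rE] := IH; [lia..|].
  by exists (r * W (desc k.+1 1)); rewrite mulgA -rE DeltaAS //; lia.
have -> : i = k.+1 by lia.
case: k {IH hi ki} kn => [|k] kn.
  by exists 1; rewrite DeltaAS // DeltaA0 mul1g mulg1 desc_cons // desc_nil.
have [||u cu uE] := @DeltaA_far k k.+2; [lia..|].
exists (W u * (W (desc k.+1 1) * W (belast (v k.+2) (desc k.+1 1)))).
rewrite DeltaAS; last by lia.
rewrite DeltaAS; last by lia.
rewrite uE [desc k.+2 1]desc_cons // artin_class_cons -[LHS]mulgA.
rewrite chain_braid; last by apply: chain_desc; lia.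
by rewrite !mulgA far_word_commute.
Qed.

(** If w = DeltaA (k-1) w' and x_k divides w, then x_k divides what remains
    after the blocks that commute with it, namely x_(k-1) ... x_1 w', and
    [chain_dvd] gives the next block x_k ... x_1 as a divisor of w'. *)
Lemma DeltaA_dvd k (w : artin_monoid e) : (k < n)%N ->
  (forall i, (1 <= i <= k)%N -> ldvd (x (v i)) w) -> ldvd (DeltaA k) w.
Proof.
elim: k => [|k IH] kn hw; first by exists w; rewrite DeltaA0 mul1g.
have [||w' wE] := IH; [lia|by move=> i hi; apply: hw; lia|].
have [t wE'] : ldvd (x (v k.+1)) w by apply: hw; lia.
case: k {IH hw} kn wE wE' => [|k] kn wE wE'.
  by exists t; rewrite DeltaAS // DeltaA0 mul1g wE' desc_cons // desc_nil.
have [||u cu uE] := @DeltaA_far k k.+2; [lia..|].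
have E := etrans (esym wE) wE'.
rewrite DeltaAS ?uE -?mulgA in E; last by lia.
have [z1 [E1 _]] := far_word_dvd D_sym D_tf cu E.
have [|z' [w'E _]] := chain_dvd D_sym D_tf _ E1.
  by apply: chain_desc; lia.
exists z'; rewrite wE w'E (DeltaAS (ltnW kn)) [desc k.+2 1]desc_cons //.
by rewrite artin_class_cons !mulgA.
Qed.

Lemma epsDSS j : epsD n j.+2 = epsD n j.
Proof. by rewrite /epsD /= negbK. Qed.

Lemma epsD_case j : (epsD n j = n.-1 \/ epsD n j = n).
Proof. by rewrite /epsD; case: odd; [right|left]. Qed.

Local Notation B j := (W (desc (n - 2) j)).
Local Notation f j := (v (epsD n j)).

Lemma epsD_far j : far e (f j) (f j.+1).
Proof.
by rewrite /epsD /=; case: (odd j); rewrite dynkinD_farE ?xpair_eqE; lia.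
Qed.

Lemma chain_eps i j : (0 < j)%N -> chain e (f i) (desc (n - 2) j).
Proof.
by move=> j0; apply: chain_desc => //; case: (epsD_case i) => ->; lia.
Qed.

Lemma QDE j : (0 < j)%N -> QD n j = x (f j) * B j.
Proof.
move=> j0; rewrite /QD descDE ?xDE //; last by lia.
by case: (epsD_case j) => ->; lia.
Qed.

(** The tail Q_j ... Q_(n-1) for p = 0; an odd p exchanges the roles of the two
    end vertices x_(n-1) and x_n. *)
Definition zigzag p j := \prod_(j <= i < n) (x (f (i + p)%N) * B i).

Lemma zigzagS p j : (j < n)%N ->
  zigzag p j = x (f (j + p)%N) * (B j * zigzag p j.+1).
Proof. by move=> jn; rewrite /zigzag big_ltn // mulgA. Qed.

Lemma zigzagn p : zigzag p n = 1.
Proof. by rewrite /zigzag big_geq. Qed.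

Lemma B_last j : j = n.-1 -> B j = 1.
Proof. by move=> ->; rewrite desc_nil //; lia. Qed.

Lemma B_braid i j (z : artin_monoid e) : (0 < j)%N -> (j <= n - 2)%N ->
  B j * (x (f i) * (B j * z)) = x (f i) * (B j * (x (f i) * (B j.+1 * z))).
Proof.
move=> j0 jn; have := chain_braid (chain_eps i j0).
by rewrite belast_desc // artin_class_cons !mulgA => ->.
Qed.

(** Write c = f (j + p) and c' for the other end vertex, and R, R' for the two
    zigzags from j + 1 on that start with c' and c. Then
    c' B_j (c B_j) R = c' c B_j c B_(j+1) R by [B_braid], the induction
    hypothesis replaces c B_(j+1) R by c' B_(j+1) R', the commuting letters c'
    and c are exchanged, and [B_braid] for c' folds the word again. *)
Lemma zigzag_swap p j : (0 < j)%N -> (j < n)%N ->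
  x (f (j + p).+1) * (B j * zigzag p j) =
  x (f (j + p)%N) * (B j * zigzag p.+1 j).
Proof.
move=> j0 jn.
have [d dE] : exists d, (d + j = n.-1)%N by exists (n.-1 - j)%N; lia.
have cj i (z : artin_monoid e) :
    x (f i.+1) * (x (f i) * z) = x (f i) * (x (f i.+1) * z).
  by have /andP[_ ?] := epsD_far i; rewrite -gen_commute.
elim: d p j j0 jn dE => [|d IH] p j j0 jn dE; rewrite !(zigzagS _ jn).
  have jE : j.+1 = n by lia.
  rewrite B_last ?mul1g; last by lia.
  by rewrite jE !zigzagn addnS cj.
rewrite B_braid //; last by lia.
have := IH p j.+1 isT; rewrite !addSn epsDSS => ->; [|lia..].
by rewrite cj addnS B_braid //; lia.
Qed.

(** The letters f j and f j.+1 commute, so both B_j w and B_j z are obtained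
    from one t by adding the opposite letter. By [chain_dvd], w = Q_j w' and
    z = f j.+1 B_j z', and the two expressions for t become, after cancelling
    B_j, the same equation for j + 1, w' and z', since f j.+2 = f j. *)
Lemma zigzag_dvd j (w z : artin_monoid e) : (0 < j)%N -> (j < n)%N ->
  x (f j.+1) * (B j * w) = x (f j) * (B j * z) -> ldvd (zigzag 0 j) w.
Proof.
move=> j0 jn.
have [d dE] : exists d, (d + j = n.-1)%N by exists (n.-1 - j)%N; lia.
elim: d j w z j0 jn dE => [|d IH] j w z j0 jn dE /esym E;
  have /andP[nj fj] := epsD_far j;
  have [t [Ez Ew]] := gen_eq_far D_sym D_tf nj fj E.
  have jE : j.+1 = n by lia.
  move: Ew; rewrite (zigzagS _ jn) addn0 jE zigzagn.
  rewrite B_last ?mul1g ?mulg1; last by lia.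
  by move=> ->; exists t.
have [w' [-> tw]] := chain_dvd D_sym D_tf (chain_eps j j0) Ew.
have [z' [_ tz]] := chain_dvd D_sym D_tf (chain_eps j.+1 j0) Ez.
have [||||r ->] := IH j.+1 w' z'; [lia..| |].
  rewrite epsDSS; apply: (class_cancel D_sym D_tf (u := desc (n - 2) j)).
  have jn2 : (j <= n - 2)%N by lia.
  by move: tw; rewrite tz !belast_desc // !artin_class_cons -!mulgA.
by exists r; rewrite (zigzagS _ jn) addn0 !mulgA.
Qed.

(** In this form of the last two blocks only B_1 and x_(n-1) interact with
    x_n. *)
Lemma DeltaA_split : DeltaA n.-1 = DeltaA (n - 3) * (B 1 * (x (f 2) * B 1)).
Proof.
have -> : n.-1 = (n - 3).+2 by lia.
have -> : (n - 2 = (n - 3).+1)%N by lia.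
rewrite !DeltaAS; [|lia..].
rewrite [desc (n - 3).+2 1]desc_cons // artin_class_cons -!mulgA.
by rewrite /epsD /= (_ : n.-1 = (n - 3).+2) //; lia.
Qed.

Definition DeltaD := DeltaA n.-1 * zigzag 0 1.

(** Only x_n needs the second part of the product: [zigzag_swap] replaces the
    factor x_(n-1) by x_n, then [B_braid] brings x_n in front of B_1, and it
    commutes with the blocks before. *)
Lemma gen_dvd_DeltaD i : ldvd (x i) DeltaD.
Proof.
have -> : i = v i.+1 by apply: val_inj; rewrite /= vE // ltn_ord.
have [ilt|ige] := ltnP i.+1 n.
  have [||r rE] := @gen_dvd_DeltaA n.-1 i.+1; [lia..|].
  by exists (r * zigzag 0 1); rewrite mulgA -rE.
have -> : v i.+1 = f 1 by rewrite /epsD /=; congr v; have := ltn_ord i; lia.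
have [||u cu uE] := @DeltaA_far (n - 3) n; [lia..|].
have n1 : (1 < n)%N by lia.
have := @zigzag_swap 0 1 isT n1; rewrite addn0 => E.
rewrite /DeltaD DeltaA_split -!mulgA E uE B_braid //; last by lia.
have -> : W u * (x (f 1) * (B 1 * (x (f 1) * (B 2 * zigzag 1 1)))) =
   x (f 1) * (W u * (B 1 * (x (f 1) * (B 2 * zigzag 1 1)))).
  by rewrite !mulgA far_word_commute.
by eexists.
Qed.

Lemma DeltaD_dvd (w : artin_monoid e) :
  (forall i, ldvd (x i) w) -> ldvd DeltaD w.
Proof.
move=> hw; have [||w' wE] := @DeltaA_dvd n.-1 w; [lia|by []|].
have [t wt] := hw (f 1).
have [||u cu uE] := @DeltaA_far (n - 3) n; [lia..|].
have E := etrans (esym wE) wt; rewrite DeltaA_split uE -!mulgA in E.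
have [z1 [E1 _]] := far_word_dvd D_sym D_tf (cu : all (far e (f 1)) u) E.
have [z2 [E2 _]] := chain_dvd D_sym D_tf (chain_eps 1 (isT : 0 < 1)%N) E1.
have [||r rE] := @zigzag_dvd 1 w' z2 _ _ E2; [by []|lia|].
by exists r; rewrite wE rE mulgA.
Qed.

Lemma DeltaDE :
  (\prod_(1 <= k < n) descD n k 1) * (\prod_(1 <= j < n) QD n j) = DeltaD.
Proof.
rewrite /DeltaD /DeltaA prednK //; congr (_ * _).
by apply: eq_big_nat => j hj; rewrite QDE ?addn0 //; case/andP: hj.
Qed.

End DynkinD.

Theorem corollary3 (n : nat) (hn : (4 <= n)%N) :
  unique (@is_garside 'I_n (@dynkinD n))
    ((\prod_(1 <= k < n) descD n k 1) * (\prod_(1 <= j < n) QD n j)).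
Proof.
have n_gt0 : (0 < n)%N by lia.
pose v k := insubd (Ordinal n_gt0) k.-1.
have vE k : (1 <= k <= n)%N -> v k = k.-1 :> nat.
  by move=> hk; rewrite val_insubd ifT //; lia.
rewrite (DeltaDE hn vE).
have gD : is_garside (DeltaD v).
  by split; [exact: gen_dvd_DeltaD|exact: DeltaD_dvd].
by split=> // d; exact: is_garside_uniq.
Qed.
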